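(* Let $d\ge 1$ be an integer and let $\mathcal{K}(\mathbb{R}^d)$ be the set of nonempty compact subsets of $\mathbb{R}^d$ (with the Euclidean metric), equipped with the Hausdorff metric. Schmidt's game is played on the complete metric space $\mathcal{K}(\mathbb{R}^d)$. Then the set $$\{K\in\mathcal{K}(\mathbb{R}^d) : 0<\dim_L K\le\dim_A K<d\}$$ is winning, but for all $\varepsilon>0$ the sets $\{K\in\mathcal{K}(\mathbb{R}^d) : \dim_A K>\varepsilon\}$ and $\{K\in\mathcal{K}(\mathbb{R}^d) : \dim_L K<d-\varepsilon\}$ are not winning.
   Context: **Schmidt's game.** Let $(Y,\rho)$ be a complete metric space and $0<\alpha,\beta<1$. The $(\alpha,\beta)$-game between Alice and Bob: Bob first chooses $r_0>0$ and $x_0\in Y$. Put $r_n=(\alpha\beta)^n r_0$. For $n=1,2,\dots$: Alice chooses $y_n\in Y$ with $\rho(x_{n-1},y_n)+\alpha r_{n-1}\le r_{n-1}$; then Bob chooses $x_n\in Y$ with $\rho(y_n,x_n)+\alpha\beta r_{n-1}\le \alpha r_{n-1}$. The closed balls $B_n=B(x_n,r_n)$ and $A_n=B(y_n,\alpha r_{n-1})$ satisfy $B_0\supseteq A_1\supseteq B_1\supseteq A_2\supseteq\cdots$ and intersect in a unique point, called the outcome. A set $S\subseteq Y$ is $(\alpha,\beta)$-winning if Alice has a strategy guaranteeing that the outcome lies in $S$; it is $\alpha$-winning if it is $(\alpha,\beta)$-winning for all $0<\beta<1$; it is winning if it is $\alpha$-winning for some $0<\alpha<1$. **Dimensions.**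 For a subset $K$ of a metric space, $N_r(K)$ denotes the minimal number of open sets of diameter at most $r$ required to cover $K$; $B(x,R)$ is the closed ball. For nonempty $K$: - The Assouad dimension $\dim_A K$ is the infimum of all $s\ge 0$ for which there is a constant $C>0$ such that for all $0<r<R$ and all $x\in K$, $N_r(B(x,R)\cap K)\le C(R/r)^s$. - The lower dimension $\dim_L K$ is the supremum of all $s\ge 0$ for which there is a constant $C>0$ such that for all $0<r<R\le\max\{\mathrm{diam}(K),1\}$ and all $x\in K$, $N_r(B(x,R)\cap K)\ge C(R/r)^s$. *)

(* Defs.v *)
From HB Require Import structures.
From mathcomp Require Import all_boot all_order all_algebra.
From mathcomp Require Import all_classical all_reals all_analysis.
From mathcomp Require Import ring.
Import Order.TTheory GRing.Theory Num.Theory.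
Import numFieldNormedType.Exports.

Set Implicit Arguments.
Unset Strict Implicit.
Unset Printing Implicit Defensive.

Local Open Scope classical_set_scope.
Local Open Scope ring_scope.

(* An alias is needed: 'rV[R]_d already carries the distance of the max norm. *)
Definition euclidean (R : realType) (d : nat) : Type := 'rV[R]_d.

HB.instance Definition _ (R : realType) (d : nat) :=
  Choice.copy (euclidean R d) 'rV[R]_d.

Section euclidean_metric.
Context {R : realType} {d : nat}.
Implicit Types u v w : 'I_d -> R.

Definition euclidean_dist (x y : euclidean R d) : R :=
  Num.sqrt (\sum_(i < d) (x 0 i - y 0 i) ^+ 2).

Let n2 u : R := Num.sqrt (\sum_(i < d) u i ^+ 2).

Let sq_ge0 u : 0 <= \sum_(i < d) u i ^+ 2.
Proof. by apply: sumr_ge0 => i _; exact: sqr_ge0. Qed.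

Let n2_sq u : n2 u ^+ 2 = \sum_(i < d) u i ^+ 2.
Proof. by rewrite sqr_sqrtr. Qed.

Let n2_eq0 u : n2 u = 0 -> forall i, u i = 0.
Proof.
move=> u0 i; have := n2_sq u; rewrite u0 expr0n/= => /esym/eqP.
rewrite psumr_eq0; last by move=> j _; exact: sqr_ge0.
by move=> /allP/(_ i (mem_index_enum i)); rewrite sqrf_eq0 => /eqP.
Qed.

Let cauchy_schwarz u v : \sum_(i < d) u i * v i <= n2 u * n2 v.
Proof.
have [u0|u0] := eqVneq (n2 u) 0.
  rewrite u0 mul0r big1// => i _.
  by rewrite n2_eq0// mul0r.
have [v0|v0] := eqVneq (n2 v) 0.
  rewrite v0 mulr0 big1// => i _.
  by rewrite [v i]n2_eq0// mulr0.
have ab : 0 < n2 u * n2 v by rewrite mulr_gt0// lt0r ?u0 ?v0 sqrtr_ge0.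
have : 0 <= \sum_(i < d) (n2 v * u i - n2 u * v i) ^+ 2.
  by apply: sumr_ge0 => i _; exact: sqr_ge0.
have -> : \sum_(i < d) (n2 v * u i - n2 u * v i) ^+ 2 =
    (n2 u * n2 v) * (2 * (n2 u * n2 v - \sum_(i < d) u i * v i)).
  transitivity (\sum_(i < d) (n2 v ^+ 2 * u i ^+ 2 + n2 u ^+ 2 * v i ^+ 2
      - (2 * (n2 u * n2 v)) * (u i * v i))).
    by apply: eq_bigr => i _; ring.
  by rewrite sumrB big_split/= -!mulr_sumr -!n2_sq; ring.
by rewrite pmulr_rge0// pmulr_rge0// subr_ge0.
Qed.

Let minkowski u v : n2 (fun i => u i + v i) <= n2 u + n2 v.
Proof.
rewrite -(@ler_pXn2r _ 2%N)// ?nnegrE ?addr_ge0 ?sqrtr_ge0// n2_sq.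
under eq_bigr => i _ do rewrite sqrrD.
rewrite big_split big_split/= -!n2_sq sqrrD lerD2r lerD2l.
by rewrite sumrMnl lerMn2r/= cauchy_schwarz.
Qed.

Let dist_xx x : euclidean_dist x x = 0.
Proof. by rewrite /euclidean_dist big1 ?sqrtr0// => i _; rewrite subrr expr0n. Qed.

Let dist_pos x y : euclidean_dist x y = 0 -> x = y.
Proof.
move=> /(@n2_eq0 (fun i => x 0 i - y 0 i)) xy.
by apply/rowP => i; apply/eqP; rewrite -subr_eq0 xy.
Qed.

Let dist_sym x y : euclidean_dist x y = euclidean_dist y x.
Proof.
by congr Num.sqrt; apply: eq_bigr => i _; rewrite -sqrrN opprB.
Qed.

Let dist_triangle y x z :
  euclidean_dist x z <= euclidean_dist x y + euclidean_dist y z.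
Proof.
apply: le_trans (minkowski (fun i => x 0 i - y 0 i) (fun i => y 0 i - z 0 i)).
rewrite le_eqVlt; apply/orP; left; apply/eqP; congr Num.sqrt; apply: eq_bigr => i _.
by rewrite addrA subrK.
Qed.

HB.instance Definition _ := isMetric.Build R (euclidean R d)
  dist_xx dist_pos dist_sym dist_triangle.

End euclidean_metric.

Record compacts (T : topologicalType) := Compacts {
  compacts_set :> set T ;
  compacts_neq0 : compacts_set !=set0 ;
  compacts_compact : compact compacts_set
}.

HB.instance Definition _ (T : topologicalType) := gen_eqMixin (compacts T).
HB.instance Definition _ (T : topologicalType) := gen_choiceMixin (compacts T).

Section hausdorff_metric.
Context {R : realType} {T : metricType R}.
Implicit Types K L M : compacts T.

Definition hausdorff_bound (A B : set T) : set R :=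
  [set e | [/\ 0 <= e,
    forall x, A x -> exists2 y, B y & mdist x y <= e &
    forall y, B y -> exists2 x, A x & mdist x y <= e]].

Definition hausdorff_dist K L : R := inf (hausdorff_bound K L).

Let bound_has_inf K L : has_inf (hausdorff_bound K L).
Proof.
split; last by exists 0 => e [].
have far M (a : T) : \forall e \near +oo%R, M `<=` [set x | mdist x a <= e].
  have /compact_near_coveringP := @compacts_compact _ M.
  move=> /(_ R +oo%R (fun e x => mdist x a <= e) _).
  apply => x Mx; exists (ball x 1, [set e | mdist x a + 1 <= e]) => /=.
    split; first exact: nbhsx_ballx.
    by apply: nbhs_pinfty_ge; exact: num_real.
  move=> [y e] /=; rewrite ballEmdist => -[/= xy xe].
  rewrite (le_trans (metric_triangle y x a))// (le_trans _ xe)// addrC lerD2l.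
  by rewrite metric_sym ltW.
have [a Ka] := compacts_neq0 K; have [b Lb] := compacts_neq0 L.
near (pinfty_nbhs R) => e; exists e; split => //.
- move=> x Kx; exists b => //.
  by have : K `<=` [set x | mdist x b <= e]; [near: e; exact: far|exact].
- move=> y Ly; exists a => //; rewrite metric_sym.
  by have : L `<=` [set x | mdist x a <= e]; [near: e; exact: far|exact].
Unshelve. all: by end_near. Qed.

Let boundC K L : hausdorff_bound K L = hausdorff_bound L K.
Proof.
by apply/seteqP; split => e [e0 KL LK]; split => // x /[dup];
  [move=> _ /LK|move=> _ /KL|move=> _ /LK|move=> _ /KL] => -[y Ay xy];
  exists y => //; rewrite metric_sym.
Qed.

Let hdist_xx K : hausdorff_dist K K = 0.
Proof.
apply/eqP; rewrite eq_le; apply/andP; split.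
  apply: ge_inf; first exact: (bound_has_inf K K).2.
  by split => // x Kx; exists x => //; rewrite mdistxx.
by apply: lb_le_inf => [|e []//]; exact: (bound_has_inf K K).1.
Qed.

Let hdist_sym K L : hausdorff_dist K L = hausdorff_dist L K.
Proof. by rewrite /hausdorff_dist boundC. Qed.

Let hdist0_sub K L : hausdorff_dist K L = 0 -> K `<=` L.
Proof.
move=> KL0 x Kx.
have /closure_id -> : closed L.
  by apply: compact_closed (@compacts_compact _ L); exact: metric_hausdorff.
move=> B /nbhs_ballP[e /= e0 eB].
have [e' [_ KL _]] := inf_adherent e0 (bound_has_inf K L).
rewrite -/(hausdorff_dist K L) KL0 add0r => e'e.
have [y Ly xy] := KL _ Kx.
by exists y; split => //; apply: eB; rewrite ballEmdist /= (le_lt_trans xy).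
Qed.

Let hdist_pos K L : hausdorff_dist K L = 0 -> K = L.
Proof.
move=> KL0; have KL : K = L :> set T.
  apply/seteqP; split; apply: hdist0_sub => //.
  by rewrite hdist_sym.
case: K L KL {KL0} => [K K1 K2] [L L1 L2] /= KL.
by subst L; congr Compacts; exact: Prop_irrelevance.
Qed.

Let hdist_triangle L K M :
  hausdorff_dist K M <= hausdorff_dist K L + hausdorff_dist L M.
Proof.
apply/ler_addgt0Pl => e e0; have e20 : 0 < e / 2 by rewrite divr_gt0.
have [s [s0 KL LK] sd] := inf_adherent e20 (bound_has_inf K L).
have [t [t0 LM ML] td] := inf_adherent e20 (bound_has_inf L M).
apply: (@le_trans _ _ (s + t)); last first.
  by rewrite /hausdorff_dist [leRHS](_ : _ = (inf (hausdorff_bound K L) + e / 2) +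
    (inf (hausdorff_bound L M) + e / 2)) ?lerD ?ltW//; field.
apply: ge_inf; first exact: (bound_has_inf K M).2.
split => [|x /KL[y /LM[z Mz yz] xy]|z /ML[y /LK[x Kx xy] yz]].
- exact: addr_ge0.
- by exists z => //; rewrite (le_trans (metric_triangle x y z))// lerD.
- by exists x => //; rewrite (le_trans (metric_triangle x y z))// lerD.
Qed.

HB.instance Definition _ := isMetric.Build R (compacts T)
  hdist_xx hdist_pos hdist_sym hdist_triangle.

End hausdorff_metric.

Section schmidt_game.
Context {R : realType} {Y : metricType R}.
Implicit Types (alpha beta r : R) (x : nat -> Y) (S : set Y).

Definition game_radius alpha beta (r0 : R) (n : nat) : R := (alpha * beta) ^+ n * r0.

(* From r0 and Bob's centers x_0, ..., x_(n-1), a strategy returns Alice's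
   center y_n; her own earlier moves are determined by these data. *)
Definition alice_strategy : Type := R -> seq Y -> Y.

(* answer sigma r0 x n is Alice's center y_(n+1), chosen after x_n. *)
Definition answer (sigma : alice_strategy) (r0 : R) x (n : nat) : Y :=
  sigma r0 (mkseq x n.+1).

Definition alice_legal alpha r (c y : Y) := mdist c y + alpha * r <= r.

Definition bob_legal alpha beta r (y c' : Y) :=
  mdist y c' + alpha * beta * r <= alpha * r.

Definition cball (c : Y) r : set Y := [set z | mdist c z <= r].

Definition winning_strategy alpha beta S (sigma : alice_strategy) : Prop :=
  forall (r0 : R) x, 0 < r0 ->
  let r := game_radius alpha beta r0 in
  let y := answer sigma r0 x in
  (forall n,
     (forall m, (m < n)%N -> bob_legal alpha beta (r m) (y m) (x m.+1)) ->
     alice_legal alpha (r n) (x n) (y n)) /\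
  ((forall n, bob_legal alpha beta (r n) (y n) (x n.+1)) ->
   exists2 z, \bigcap_n (cball (x n) (r n) `&` cball (y n) (alpha * r n)) = [set z]
            & S z).

Definition ab_winning alpha beta S : Prop :=
  exists sigma, winning_strategy alpha beta S sigma.

Definition alpha_winning alpha S : Prop :=
  forall beta, 0 < beta < 1 -> ab_winning alpha beta S.

Definition winning S : Prop :=
  exists2 alpha, 0 < alpha < 1 & alpha_winning alpha S.

End schmidt_game.

Section dimensions.
Context {R : realType} {T : metricType R}.
Implicit Types (A K : set T) (r s C : R).
Local Open Scope ereal_scope.

(* The empty set has diameter -oo here, hence is allowed in every cover. *)
Definition diam A : \bar R :=
  ereal_sup [set (mdist p.1 p.2)%:E | p in A `*` A].

(* +oo if there is no finite cover *)
Definition covering_number r A : \bar R :=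
  ereal_inf [set n%:R%:E | n in [set n : nat | exists U : 'I_n -> set T,
    (forall i, open (U i) /\ diam (U i) <= r%:E) /\
    A `<=` \bigcup_(i in setT) U i]].

Definition dimA K : \bar R :=
  ereal_inf [set s%:E | s in [set s | (0 <= s)%R /\
    exists2 C, (0 < C)%R & forall r rho x, (0 < r < rho)%R -> K x ->
      covering_number r (cball x rho `&` K) <= (C * (rho / r) `^ s)%:E]].

Definition dimL K : \bar R :=
  ereal_sup [set s%:E | s in [set s | (0 <= s)%R /\
    exists2 C, (0 < C)%R & forall r rho x, (0 < r < rho)%R ->
      rho%:E <= maxe (diam K) 1 -> K x ->
      (C * (rho / r) `^ s)%:E <= covering_number r (cball x rho `&` K)]].

End dimensions.

(* Main.v *)
(** All moves in both strategies replace a compact set by finitely many points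
    near a grid.

    Winning: with alpha = 1/(64 d), Alice answers a ball of radius r by rounding
    its center to the grid of mesh delta = r/(4d) and adding a translate by
    (delta, ..., delta).  The outcome K then stays within delta/16 of that grid.
    Each point splits into two separated points at every scale, so dim_L K > 0;
    and at every scale K avoids a slab between two grid hyperplanes, so K is
    porous and dim_A K < d.

    Not winning: Bob plays with a tiny beta.  If he rounds Alice's set to a grid of
    mesh comparable to alpha r, then each ball splits into at most M balls of
    radius alpha beta r with M independent of beta, so dim_A K <= log M / |log
    (alpha beta)| -> 0.  If he fills a ball of radius comparable to alpha r around
    each point of Alice's set by J^d grid points with J comparable to 1/beta, then
    dim_L K >= d log J / |log (alpha beta)| -> d. *)
Require Import Defs.
From mathcomp Require Import all_boot all_order all_algebra.
From mathcomp Require Import all_classical all_reals all_analysis.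
From mathcomp Require Import ring lra zify.
Import Order.TTheory GRing.Theory Num.Theory.
Import numFieldNormedType.Exports.

Set Implicit Arguments.
Unset Strict Implicit.
Unset Printing Implicit Defensive.

Local Open Scope classical_set_scope.
Local Open Scope ring_scope.

(** * The Hausdorff metric *)

Section compact_metric.
Context {R : realType} {T : metricType R}.
Implicit Types (K L : compacts T) (x y c : T) (e r : R).

Lemma mdist_continuous x : continuous (mdist x : T -> R).
Proof.
move=> y; apply/cvgrPdist_lt => e e0.
near=> z; rewrite ltr_norml.
have : mdist y z < e.
  by near: z; have := nbhsx_ballx y _ e0; rewrite ballEmdist.
have := metric_triangle x y z; have := metric_triangle x z y.
rewrite (metric_sym z y) => h1 h2 h3; apply/andP; split; lra.
Unshelve. all: by end_near. Qed.

Lemma cball_closed c r : closed (cball c r).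
Proof.
by apply: (@preimage_closed _ _ (mdist c) [set s | s <= r]) => [y _|];
  [exact: mdist_continuous|exact: closed_le].
Qed.

Lemma hausdorff_bound_nonempty K L : hausdorff_bound K L !=set0.
Proof.
have far (M : compacts T) (a : T) : exists E, forall z, compacts_set M z -> mdist a z <= E.
  have [b /set_mem Mb bmax] := compact_EVT_max (compacts_neq0 M)
    (@compacts_compact _ M)
    (continuous_subspaceT (@mdist_continuous a)).
  by exists (mdist a b) => z Mz; apply: bmax; exact/mem_set.
have [a Ka] := compacts_neq0 K; have [b Lb] := compacts_neq0 L.
have [E1 KE1] := far K b; have [E2 LE2] := far L a.
exists (Num.max E1 E2); split.
- by rewrite le_max (le_trans _ (KE1 _ Ka)) ?mdist_ge0.
- by move=> x Kx; exists b => //; rewrite metric_sym le_max KE1.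
- by move=> x Lx; exists a => //; rewrite le_max LE2// orbT.
Qed.

Lemma mdist_compacts_le K L e : 0 <= e ->
  (forall x, compacts_set K x -> exists2 y, compacts_set L y & mdist x y <= e) ->
  (forall y, compacts_set L y -> exists2 x, compacts_set K x & mdist x y <= e) ->
  mdist K L <= e.
Proof.
move=> e0 KL LK; apply: ge_inf; last by split.
by exists 0 => ? [].
Qed.

(** The Hausdorff distance is an infimum of admissible bounds, but compactness of [L] supplies a
    nearest point to [x], so the bound [e] holds with no added error. *)
Lemma mdist_compacts_near K L e x : mdist K L <= e -> compacts_set K x ->
  exists2 y, compacts_set L y & mdist x y <= e.
Proof.
move=> KLe Kx.
have [y /set_mem Ly ymin] := compact_EVT_min (compacts_neq0 L)
  (@compacts_compact _ L) (continuous_subspaceT (@mdist_continuous x)).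
exists y => //; apply/ler_addgt0Pl => d d0.
have [|e' [_ KL _] e'd] := @inf_adherent _ (hausdorff_bound K L) _ d0.
  split; first exact: hausdorff_bound_nonempty.
  by exists 0 => ? [].
have [z Lz xz] := KL _ Kx.
apply: (le_trans (ymin z (mem_set Lz))); apply: (le_trans xz).
apply: (le_trans (ltW e'd)); rewrite addrC lerD2l; exact: KLe.
Qed.

Lemma compacts_bounded K :
  exists2 E, 0 < E & forall x y, compacts_set K x -> compacts_set K y -> mdist x y <= E.
Proof.
have [a Ka] := compacts_neq0 K.
have [b _ bmax] := compact_EVT_max (compacts_neq0 K)
    (@compacts_compact _ K) (continuous_subspaceT (@mdist_continuous a)).
exists (mdist a b *+ 2 + 1) => [|x y Kx Ky]; first by have := mdist_ge0 a b; lra.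
have := metric_triangle x a y; have := bmax x (mem_set Kx).
have := bmax y (mem_set Ky); rewrite (metric_sym x a); lra.
Qed.

End compact_metric.

(** * Cubes and compact balls in Euclidean space *)

Section euclidean_cubes.
Context {R : realType} {d : nat}.
Implicit Types (x y z a : euclidean R d) (e r t : R).

Lemma coord_le_mdist x y i : `|x 0 i - y 0 i| <= mdist x y.
Proof.
rewrite -sqrtr_sqr; apply: ler_wsqrtr.
by rewrite (bigD1 i)//= lerDl; apply: sumr_ge0 => j _; exact: sqr_ge0.
Qed.

Lemma mdist_le_coord x y e : 0 <= e -> (forall i, `|x 0 i - y 0 i| <= e) ->
  mdist x y <= d%:R * e.
Proof.
move=> e0 xye; rewrite -(ger0_norm (mulr_ge0 (ler0n _ _) e0)) -sqrtr_sqr.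
apply: ler_wsqrtr; apply: (@le_trans _ _ (\sum_(i < d) e ^+ 2)).
  by apply: ler_sum => i _; rewrite -real_normK ?num_real// ler_pXn2r ?nnegrE.
rewrite sumr_const card_ord exprMn -[leLHS]mulr_natl ler_wpM2r ?sqr_ge0//.
by case: (d) => [|n]; rewrite ?expr0n//= -natrX ler_nat expnS expn1 leq_pmulr.
Qed.

Definition cube a t : set (euclidean R d) :=
  [set z | forall i, `|z 0 i - a 0 i| <= t].

Lemma cball_sub_cube a t : cball a t `<=` cube a t.
Proof. by move=> x ax i; rewrite distrC (le_trans (coord_le_mdist _ _ _)). Qed.

(** A product of segments is compact for the max norm; the identity carries this to the Euclidean
    metric, being continuous by [mdist_le_coord]. *)
Lemma cube_compact a t : compact (cube a t).
Proof.
have cbox := @rV_compact R d (fun i => `[a 0 i - t, a 0 i + t]%classic)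
  (fun i => @segment_compact R _ _).
have -> : cube a t = (id : 'rV[R]_d -> euclidean R d) @`
    [set v : 'rV[R]_d | forall i, `[a 0 i - t, a 0 i + t]%classic (v ord0 i)].
  apply/seteqP; split => [x ax|_ [x ax <-] i].
    by exists x => // i; rewrite /= in_itv/= -ler_distl.
  by have := ax i; rewrite /= in_itv/= -ler_distl.
apply: continuous_compact cbox; apply: continuous_subspaceT => x.
have FF : Filter (nbhs (x : 'rV[R]_d)) := nbhs_filter _.
apply/(@metricType_numDomainType.cvgrPdist_lt R (euclidean R d) _ _ FF) => e e0.
(* Dividing by [d.+1] rather than [d] makes the final inequality strict and covers [d = 0]. *)
have D0 : 0 < e / d.+1%:R by rewrite divr_gt0.
have := @nbhsx_ballx R 'rV[R]_d x _ D0; apply: filterS => y [_ xy].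
apply: (@le_lt_trans _ _ (d%:R * (e / d.+1%:R))).
  by apply: mdist_le_coord => [|i]; [exact: ltW|exact/ltW/xy].
by rewrite mulrCA gtr_pMr// ltr_pdivrMr// mul1r ltr_nat.
Qed.

Lemma cball_compact a r : compact (cball a r).
Proof.
apply: subclosed_compact (@cube_compact a r) (@cball_sub_cube a r).
exact: cball_closed.
Qed.

End euclidean_cubes.

(** * Completeness of the space of compact sets along nested balls *)

Section completeness.
Context {R : realType} {d : nat}.
Variables (x : nat -> compacts (euclidean R d)) (r : nat -> R).
Hypothesis r_ge0 : forall n, 0 <= r n.
Hypothesis x_nested : forall n, mdist (x n) (x n.+1) + r n.+1 <= r n.

Let x_nestedD n k : mdist (x n) (x (n + k)%N) + r (n + k)%N <= r n.
Proof.
elim: k => [|k IH]; first by rewrite addn0 mdistxx add0r.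
have := x_nested (n + k); have := metric_triangle (x n) (x (n + k)%N) (x (n + k).+1).
by rewrite addnS; lra.
Qed.

Let x_le n m : (n <= m)%N -> mdist (x n) (x m) <= r n.
Proof.
move=> nm; have := x_nestedD n (m - n); rewrite subnKC//.
by have := r_ge0 m; lra.
Qed.

Let near n : set (euclidean R d) :=
  [set z | exists2 p, compacts_set (x n) p & mdist p z <= r n].

(* A cluster point of the centers [q m], m >= n, lies in every [near k]. *)
Let chain_limit n p : compacts_set (x n) p ->
  exists2 z, (forall k, near k z) & mdist p z <= r n.
Proof.
move=> xp.
have /choice[q xq] m : exists q, (n <= m)%N -> compacts_set (x m) q /\ mdist p q <= r n.
  (* Only indices [m >= n] matter; [p] is a filler below [n]. *)
  have [nm|] := leqP n m; last by exists p.
  by have [q ? ?] := mdist_compacts_near (x_le nm) xp; exists q.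
have qn : \forall m \near \oo, (cball p (r n)) (q m).
  by exists n => // m /xq[].
have [z [pz qz]] := @cball_compact R d p (r n) (q @ \oo) _ qn.
exists z => // k.
have [c /set_mem xc cmin] := compact_EVT_min (compacts_neq0 (x k))
  (@compacts_compact _ (x k)) (continuous_subspaceT (@mdist_continuous _ _ z)).
exists c => //; rewrite metric_sym; apply/ler_addgt0Pl => e e0.
have nk : \forall m \near \oo, (n <= m)%N /\ (k <= m)%N.
  by exists (maxn n k) => // m /=; rewrite geq_max => /andP[].
have nk' : (q @ \oo) [set w | exists m, [/\ (n <= m)%N, (k <= m)%N & w = q m]].
  by apply: filterS nk => m [] ? ?; exists m.
have [w [[m [nm km ->]]]] := qz _ _ nk' (nbhsx_ballx z _ e0).
rewrite ballEmdist /= => zqm.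
have [xqm _] := xq m nm.
have xmk : mdist (x m) (x k) <= r k by rewrite metric_sym x_le.
have [b xb qb] := mdist_compacts_near xmk xqm.
have := cmin b (mem_set xb); have := metric_triangle z (q m) b; lra.
Qed.

(** The limit is the set of points within [r k] of [x k] for every [k]. It is closed and bounded,
    hence compact, and [chain_limit] finds one of its points within [r n] of any point of [x n]. *)
Lemma compacts_complete : exists z, forall n, mdist (x n) z <= r n.
Proof.
have [p xp] := compacts_neq0 (x 0).
have [z0 z0n _] := chain_limit xp.
pose K := [set z | forall k, near k z].
have cK : compact K.
  have [E E0 xE] := compacts_bounded (x 0).
  apply: (@subclosed_compact _ _ (cball p (E + r 0%N))); last first.
  - move=> z /(_ 0%N)[c xc cz]; rewrite /cball/=.
    by have := xE _ _ xp xc; have := metric_triangle p c z; lra.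
  - exact: cball_compact.
  - move=> z clz k.
    have [c /set_mem xc cmin] := compact_EVT_min (compacts_neq0 (x k))
      (@compacts_compact _ (x k)) (continuous_subspaceT (@mdist_continuous _ _ z)).
    exists c => //; rewrite metric_sym; apply/ler_addgt0Pl => e e0.
    have [w [/(_ k)[b xb bw]]] := clz _ (nbhsx_ballx z _ e0).
    rewrite ballEmdist /= => zw.
    have := cmin b (mem_set xb); have := metric_triangle z w b.
    by rewrite (metric_sym w b); lra.
exists (Compacts (ex_intro _ z0 z0n) cK) => n.
apply: mdist_compacts_le => //= [q /chain_limit[z ? ?]|z /(_ n)//]; by exists z.
Qed.

End completeness.

(** * Covering numbers and geometric scales *)

Section covering_number.
Context {R : realType} {T : metricType R}.
Implicit Types (A : set T) (r : R).

(** Open balls of radius [r / 2] have diameter at most [r]; the strict inequality is there because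
    covers consist of open sets. *)
Lemma covering_number_le_balls r A (l : seq T) :
  (forall z, A z -> exists2 b, b \in l & mdist b z < r / 2) ->
  (covering_number r A <= (size l)%:R%:E)%E.
Proof.
move=> Al; apply: ereal_inf_lbound; exists (size l) => //.
exists (fun i => ball (tnth (in_tuple l) i) (r / 2)); split => [i|z /Al[b bl bz]].
  rewrite ballEmdist; split.
    by apply: (@open_comp _ _ _ [set s | s < r / 2]) => [y _|];
      [exact: mdist_continuous|exact: open_lt].
  apply: ge_ereal_sup => _ [[x y] /= [xb yb] <-]; rewrite lee_fin.
  move: xb yb; set c := tnth _ _.
  by have := metric_triangle x c y; rewrite (metric_sym x c); lra.
have /seq_tnthP[i bi] := bl.
by exists i => //; rewrite ballEmdist /= -[tnth _ _]bi.
Qed.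

(** A set of diameter at most [r] contains at most one of the points [f i], so sending [i] to a
    covering set that contains [f i] is injective. *)
Lemma covering_number_ge_separated (I : finType) (f : I -> T) r A :
  (forall i, A (f i)) -> (forall i j, i != j -> r < mdist (f i) (f j)) ->
  (#|I|%:R%:E <= covering_number r A)%E.
Proof.
move=> Af fr; apply: le_ereal_inf_tmp => _ [n [U [Ur AU]] <-].
rewrite lee_fin ler_nat.
have /choice[g fg] i : exists j : 'I_n, U j (f i).
  by have [j _ ?] := AU _ (Af i); exists j.
rewrite -[leqRHS]card_ord; apply: (@leq_card _ _ g) => i j gij.
apply/eqP; apply: contraT => /fr; rewrite ltNge => /negP; case.
rewrite -lee_fin; apply: le_trans (Ur (g i)).2; apply: ereal_sup_ubound.
by exists (f i, f j) => //; split => /=; [|rewrite gij]; exact: fg.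
Qed.

End covering_number.

(** The least exponent is taken, so the preceding scale still exceeds [a]. At exponent 0 there is no
    preceding scale, and callers treat that case apart. *)
Lemma exists_scale (R : realType) (theta t a : R) : 0 < theta < 1 -> 0 < a ->
  exists n, theta ^+ n * t <= a /\ ((0 < n)%N -> a < theta ^+ n.-1 * t).
Proof.
move=> /andP[th0 th1] a0.
have ex : exists n, theta ^+ n * t <= a.
  have /(cvg_geometric t) : `|theta| < 1 by rewrite gtr0_norm.
  move=> /cvgr0Pnorm_lt/(_ _ a0)[n _ /(_ n (leqnn n))] /=.
  by move=> /(le_lt_trans (ler_norm _))/ltW; rewrite mulrC; exists n.
exists (ex_minn ex); case: ex_minnP => n tn nmin; split => // n0.
by rewrite ltNge; apply/negP => /nmin; rewrite leqNgt prednK ?leqnn.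
Qed.

Lemma powR_le_count (R : realType) (theta s : R) (M k : nat) : 0 < theta ->
  M%:R <= theta^-1 `^ s -> (M ^ k)%:R <= ((theta ^+ k)^-1) `^ s.
Proof.
move=> th0 Ms; rewrite -exprVn -powR_mulrn ?invr_ge0 ?(ltW th0)// -powRrM mulrC powRrM.
by rewrite powR_mulrn ?powR_ge0// natrX lerXn2r ?nnegrE ?powR_ge0.
Qed.

Lemma powR_count_le (R : realType) (theta s : R) (M k : nat) : 0 < theta ->
  theta^-1 `^ s <= M%:R -> ((theta ^+ k)^-1) `^ s <= (M ^ k)%:R.
Proof.
move=> th0 Ms; rewrite -exprVn -powR_mulrn ?invr_ge0 ?(ltW th0)// -powRrM mulrC powRrM.
by rewrite powR_mulrn ?powR_ge0// natrX lerXn2r ?nnegrE ?powR_ge0.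
Qed.

(** * Box-counting criteria for the dimensions *)

Section assouad_upper_bound.
Context {R : realType} {d : nat}.
Variables (K : set (euclidean R d)) (theta t0 s : R) (M : nat).
Let t n := theta ^+ n * t0.
Hypotheses (theta01 : 0 < theta < 1) (t0_gt0 : 0 < t0) (s_ge0 : 0 <= s).
Hypothesis M_le : M%:R <= theta^-1 `^ s.
Hypothesis K_diam : forall x y, K x -> K y -> mdist x y <= t0.
Hypothesis K_branch : forall n a, exists2 l : seq (euclidean R d), (size l <= M)%N &
  forall z, K z -> cube a (t n) z -> exists2 b, b \in l & cube b (t n.+1) z.

Let K_branch_iter k n a :
  exists2 l : seq (euclidean R d), (size l <= M ^ k)%N &
  forall z, K z -> cube a (t n) z -> exists2 b, b \in l & cube b (t (n + k)%N) z.
Proof.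
elim: k => [|k [l lM Kl]].
  by exists [:: a] => // z _ az; exists a; rewrite ?mem_seq1 ?addn0.
have /choice[g gP] b : exists l' : seq (euclidean R d), (size l' <= M)%N /\
    forall z, K z -> cube b (t (n + k)%N) z ->
    exists2 c, c \in l' & cube c (t (n + k).+1) z.
  by have [l' ? ?] := K_branch (n + k) b; exists l'.
exists (flatten [seq g b | b <- l]).
  apply: leq_trans (_ : size l * M <= _)%N; last by rewrite expnSr leq_mul2r lM orbT.
  elim: (l) => //= b l' IH; rewrite size_cat mulSn leq_add//; exact: (gP b).1.
move=> z Kz /(Kl z Kz)[b bl bz]; have [c cg cz] := (gP b).2 z Kz bz.
by exists c; rewrite ?addnS//; apply/flatten_mapP; exists b.
Qed.

(** A ball of radius [rho] meets [K] inside one cube of a scale comparable to [rho]. After [k]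
    branchings the cubes have size comparable to [r], so [M ^ k] sets suffice, and [theta ^- k] is
    at most a constant times [rho / r]. *)
Lemma dimA_le : (dimA K <= s%:E)%E.
Proof.
have /andP[th0 th1] := theta01.
have tgt0 n : 0 < t n by rewrite mulr_gt0// exprn_gt0.
(* A cube of half-side [t] lies in an open ball of radius [d.+1 * t], so diameter [r] is reached
   once [D * t <= r]. *)
pose D : R := 2 * d.+1%:R; have D0 : 0 < D by rewrite mulr_gt0.
(* The term 1 serves [k = 0]; otherwise one factor [theta] is lost in fitting [rho] to a scale and
   another in fitting [r]. *)
pose C := 1 + D / theta ^+ 2; have C1 : 1 <= C.
  by rewrite lerDl divr_ge0// ?exprn_ge0 ?(ltW D0) ?(ltW th0).
apply: ereal_inf_lbound; exists s => //; split => //.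
exists (C `^ s); first by rewrite powR_gt0//; lra.
move=> r rho x /andP[r0 rrho] Kx.
have rho0 : 0 < rho by lra.
have [n Kn nrho] : exists2 n, cball x rho `&` K `<=` cube x (t n) & theta * t n <= rho.
  have [n [tn ntn]] := exists_scale t0 theta01 rho0.
  (* If [rho >= t0], the cube of scale 0 already contains [K] by the diameter bound; otherwise the
     last scale above [rho] is used. *)
  case: n tn ntn => [|n] tn ntn.
    exists 0%N => [z [_ Kz]|]; last by rewrite (le_trans _ tn)// ger_pMl ?(ltW th1).
    by apply: cball_sub_cube; rewrite /cball /= /t expr0 mul1r K_diam.
  exists n => [z [xz _]|]; last by rewrite /t mulrA -exprS.
  by apply: cball_sub_cube; apply: (le_trans xz); apply/ltW/ntn.
have [k [tk ktk]] := exists_scale (D * t n) theta01 r0.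
have [l lM Kl] := K_branch_iter k n x.
have {}tk : D * t (n + k)%N <= r 
  by rewrite (_ : D * _ = theta ^+ k * (D * t n))// /t exprD; ring.
have k_le : (theta ^+ k)^-1 <= C * (rho / r).
  have rhor : 1 <= rho / r by rewrite ler_pdivlMr// mul1r ltW.
  case: k ktk {lM Kl tk} => [|k] ktk; first by rewrite expr0 invr1 mulr_ege1.
  have {}ktk := ktk isT; rewrite /= in ktk.
  apply: (@le_trans _ _ (D / theta ^+ 2 * (rho / r))); last first.
    by rewrite ler_wpM2r ?lerDr// divr_ge0 ?(ltW r0) ?(ltW rho0).
  rewrite (_ : D / _ * _ = (D * rho) / (theta ^+ 2 * r)); last by field; rewrite !gt_eqF.
  rewrite ler_pdivlMr ?mulr_gt0 ?exprn_gt0// ler_pdivrMl ?exprn_gt0//.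
  rewrite (_ : theta ^+ 2 * r = theta * (theta * r)); last by ring.
  rewrite (_ : theta ^+ k.+1 * _ = theta * (theta ^+ k * D * rho)); last first.
    by rewrite exprS; ring.
  rewrite ler_wpM2l ?(ltW th0)//.
  apply: (@le_trans _ _ (theta * (theta ^+ k * (D * t n)))).
    by rewrite ler_wpM2l ?ltW.
  rewrite (_ : theta * _ = (theta ^+ k * D) * (theta * t n)); last by ring.
  by rewrite ler_wpM2l// mulr_ge0 ?exprn_ge0 ?ltW.
apply: le_trans (covering_number_le_balls (l := l) _) _.
  move=> z [xz Kz]; have [b bl bz] := Kl z Kz (Kn z (conj xz Kz)).
  exists b => //; apply: (@le_lt_trans _ _ (d%:R * t (n + k)%N)).
    by rewrite mdist_le_coord ?(ltW (tgt0 _))// => i; rewrite distrC.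
  apply: (@lt_le_trans _ _ (d.+1%:R * t (n + k)%N)); first by rewrite ltr_pM2r ?ltr_nat.
  by move: tk; rewrite /D; lra.
rewrite lee_fin -powRM ?divr_ge0 ?(ltW r0) ?(ltW rho0)//; last lra.
apply: (@le_trans _ _ (M ^ k)%:R); first by rewrite ler_nat.
apply: (le_trans (powR_le_count k th0 M_le)); apply: ge0_ler_powR => //.
  by rewrite nnegrE invr_ge0 exprn_ge0 ?(ltW th0).
by rewrite nnegrE mulr_ge0 ?divr_ge0//; lra.
Qed.

End assouad_upper_bound.

(** * Lower dimension from separated branching *)

Section lower_dimension_bound.
Context {R : realType} {T : metricType R}.
Variables (K : set T) (theta t0 s E : R) (I : finType).
Let t n := theta ^+ n * t0.
Hypotheses (theta_gt0 : 0 < theta) (theta_le : theta <= 2^-1).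
Hypotheses (t0_gt0 : 0 < t0) (s_ge0 : 0 <= s) (E_gt0 : 0 < E).
Hypothesis I_ge : theta^-1 `^ s <= #|I|%:R.
Hypothesis K_diam : forall x y, K x -> K y -> mdist x y <= E.
Hypothesis K_branch : forall n x, K x -> exists2 f : I -> T,
  forall i, K (f i) /\ mdist x (f i) <= t n / 2 &
  forall i j, i != j -> 2 * t n.+1 < mdist (f i) (f j).

Let t_gt0 n : 0 < t n. Proof. by rewrite mulr_gt0// exprn_gt0. Qed.

Let t_half n : t n.+1 <= t n / 2.
Proof. by rewrite /t exprS -mulrA mulrC ler_wpM2l// (ltW (t_gt0 n)). Qed.

(** As [theta <= 1/2], a displacement [t m / 2] is at most [t m - t m.+1], so displacements
    telescope. Children of distinct parents stay more than [2 * t m - t m >= 2 * t m.+1] apart. *)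
Let K_branch_iter k n x : K x -> exists (J : finType) (f : J -> T),
  [/\ #|J| = (#|I| ^ k)%N, forall j, K (f j) /\ mdist x (f j) <= t n - t (n + k)%N &
      forall i j, i != j -> 2 * t (n + k)%N < mdist (f i) (f j)].
Proof.
move=> Kx; elim: k => [|k [J [f [cJ Kf fsep]]]].
  exists unit, (fun=> x); split => [|_|[] []//]; first by rewrite card_unit.
  by rewrite mdistxx addn0 subrr.
have /choice[g gP] j : exists g : I -> T,
    (forall i, K (g i) /\ mdist (f j) (g i) <= t (n + k)%N / 2) /\
    (forall i i', i != i' -> 2 * t (n + k).+1 < mdist (g i) (g i')).
  by have [g ? ?] := K_branch (n + k) (Kf j).1; exists g.
exists (J * I)%type, (fun p => g p.1 p.2); rewrite addnS; split.
- by rewrite card_prod cJ expnSr.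
- move=> [j i] /=; split; first exact: ((gP j).1 i).1.
  have := (Kf j).2; have := ((gP j).1 i).2; have := t_half (n + k).
  by have := metric_triangle x (f j) (g j i); lra.
- move=> [j i] [j' i'] /=; have [<-|jj' _] := eqVneq j j'.
    by rewrite xpair_eqE eqxx /=; exact: (gP j).2.
  have := fsep _ _ jj'; have := ((gP j).1 i).2; have := ((gP j').1 i').2.
  have := t_half (n + k); have := metric_triangle (f j) (g j i) (f j').
  have := metric_triangle (g j i) (g j' i') (f j').
  by rewrite (metric_sym (g j' i') (f j')); have := t_gt0 (n + k); lra.
Qed.

(** Branching [k.-1] times below a scale [t n <= rho] yields points of the ball that are more than
    [r] apart; each needs its own covering set. *)
Lemma dimL_ge : (s%:E <= dimL K)%E.
Proof.
have theta01 : 0 < theta < 1 by apply/andP; split => //; have := theta_le; lra.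
(* [theta^-1] pays for fitting [rho] to a scale, [(E + 1) / t0] for radii beyond the top scale, and
   [2 * theta] for fitting [r]. *)
pose C := (theta^-1 + (E + 1) / t0) / (2 * theta).
have E1 : 0 < E + 1 by rewrite addr_gt0.
have C0 : 0 < C by rewrite divr_gt0 ?mulr_gt0// addr_gt0 ?invr_gt0// divr_gt0.
apply: ereal_sup_ubound; exists s => //; split => //.
exists (C `^ (- s)); first by rewrite powR_gt0.
move=> r rho x /andP[r0 rrho] rhoK Kx.
have rho0 : 0 < rho by lra.
have {rhoK} rhoE : rho <= E + 1.
  rewrite -lee_fin; apply: (le_trans rhoK); rewrite ge_max; apply/andP; split.
    apply: ge_ereal_sup => _ [[y z] /= [Ky Kz] <-]; rewrite lee_fin.
    by have := K_diam Ky Kz; lra.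
  by rewrite lee_fin lerDr ltW.
have [n [tn ntn]] := exists_scale t0 theta01 rho0.
have rho_le : rho <= (theta^-1 + (E + 1) / t0) * t n.
  rewrite mulrDl; case: n ntn {tn} => [_|n /(_ isT)/= ntn].
    rewrite /t expr0 mul1r divfK ?gt_eqF//.
    by rewrite (le_trans rhoE)// lerDr mulr_ge0// ?invr_ge0 ltW.
  rewrite {1}/t exprS -mulrA mulKf ?gt_eqF//.
  have : 0 < (E + 1) / t0 * t n.+1 by rewrite mulr_gt0// divr_gt0.
  lra.
have [k [tk ktk]] := exists_scale (2 * t n) theta01 r0.
have k_ge : rho / r <= C * (theta ^+ k.-1)^-1.
  have {}tk : theta * (theta ^+ k.-1 * (2 * t n)) <= r.
    case: k tk {ktk} => [|k]; last by rewrite exprS -mulrA.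
    rewrite !expr0 !mul1r; apply: le_trans; rewrite ger_pMl; first lra.
    by rewrite mulr_gt0.
  rewrite ler_pdivrMr//; apply: (le_trans rho_le).
  apply: (@le_trans _ _ (C / theta ^+ k.-1 * (theta * (theta ^+ k.-1 * (2 * t n)))));
    last first.
    by rewrite ler_wpM2l// divr_ge0 ?exprn_ge0 ?(ltW C0) ?(ltW theta_gt0).
  rewrite le_eqVlt; apply/orP; left; apply/eqP; rewrite /C; field.
  by rewrite !gt_eqF// exprn_gt0.
have [J [f [cJ Kf fsep]]] := K_branch_iter k.-1 n Kx.
apply: (@le_trans _ _ #|J|%:R%:E); last first.
  apply: (covering_number_ge_separated (f := f)) => [j|i j ij].
    split; last exact: (Kf j).1.
    have := (Kf j).2; have := t_gt0 (n + k.-1); rewrite /cball /= -/(t n) in tn *; lra.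
  (* For [k = 0] the family has a single point and separation is vacuous; otherwise [k.-1] is the
     last level whose separation exceeds [r]. *)
  case: k tk ktk {k_ge Kf} f fsep cJ => [|k] tk /= ktk f fsep cJ.
    have /fintype_le1P/(_ i j) ij' : (#|J| <= 1)%N by rewrite cJ.
    by rewrite ij' eqxx in ij.
  apply: le_lt_trans (fsep _ _ ij); apply/ltW/(lt_le_trans (ktk isT)).
  by rewrite le_eqVlt /t exprD; apply/orP; left; apply/eqP; ring.
rewrite lee_fin cJ; apply: le_trans (powR_count_le k.-1 theta_gt0 I_ge).
have k0 : 0 <= (theta ^+ k.-1)^-1 by rewrite invr_ge0 exprn_ge0// ltW.
rewrite powRN mulrC ler_pdivrMr ?powR_gt0// -powRM ?(ltW C0)// mulrC.
apply: ge0_ler_powR => //; rewrite ?nnegrE.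
- by rewrite mulr_ge0 ?invr_ge0 ?(ltW rho0) ?(ltW r0).
- by rewrite mulr_ge0// ltW.
- by rewrite mulrC [leRHS]mulrC.
Qed.

End lower_dimension_bound.

(** Both bounds apply to the ball of radius 1, which the maximum with 1 in [dimL] always admits. An
    exponent [s > u] would then contradict them for small [r]. *)
Lemma dimL_le_dimA (R : realType) (T : metricType R) (K : set T) :
  K !=set0 -> (dimL K <= dimA K)%E.
Proof.
move=> [x Kx]; apply: ge_ereal_sup => _ [s [s0 [C C0 Cs]] <-].
apply: le_ereal_inf_tmp => _ [u [u0 [D D0 Du]] <-]; rewrite lee_fin leNgt.
apply/negP => us.
have bound r : 0 < r < 1 -> C * (1 / r) `^ s <= D * (1 / r) `^ u.
  move=> r01; rewrite -lee_fin; apply: (le_trans (Cs r 1 x r01 _ Kx)).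
    by rewrite le_max lexx orbT.
  exact: Du.
have e0 : 0 < (s - u)^-1 by rewrite invr_gt0 subr_gt0.
(* [q] is the inverse radius: its power [s - u] exceeds [D / C], and the final [+ 1] forces [q > 1],
   hence a radius below 1. *)
pose q := (D / C + 1) `^ ((s - u)^-1) + 1.
have q1 : 1 < q by rewrite ltrDr powR_gt0// addr_gt0// divr_gt0.
have q0 : 0 < q by exact: lt_trans ltr01 q1.
have := bound q^-1; rewrite invr_gt0 q0 invf_lt1// q1 div1r invrK => /(_ isT).
apply/negP; rewrite -ltNge.
rewrite -(subrK u s) powRD; last by rewrite (gt_eqF q0) implybT.
rewrite mulrA ltr_pM2r ?powR_gt0//.
rewrite mulrC -ltr_pdivrMr//; apply: (@lt_le_trans _ _ (D / C + 1)); first by rewrite ltrDl.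
have DC0 : 0 <= D / C + 1 by rewrite addr_ge0// divr_ge0// ltW.
have qs : ((D / C + 1) `^ (s - u)^-1) `^ (s - u) = D / C + 1.
  by rewrite -powRrM mulVf ?powRr1// subr_eq0 gt_eqF.
rewrite -{1}qs; apply: ge0_ler_powR; rewrite ?nnegrE ?powR_ge0 ?subr_ge0 ?(ltW us)//.
- by rewrite ltW.
- by rewrite lerDl.
Qed.

(** The points compared with [z] are the midpoints of the [N] equal pieces of [[a - t, a + t]], each
    of half-length [t / N]. *)
Lemma subinterval (R : realType) (a t z : R) (N : nat) : 0 < t -> (0 < N)%N ->
  `|z - a| <= t ->
  exists j : 'I_N, `|z - (a - t + t / N%:R * (j : nat).*2.+1%:R)| <= t / N%:R.
Proof.
move=> t0 N0 zat; have N0' : 0 < N%:R :> R by rewrite ltr0n.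
have [h h0 hE] : exists2 h, 0 < h & t / N%:R = h by eexists; last by []; exact: divr_gt0.
have tE : t = h * N%:R by rewrite -hE divfK// gt_eqF.
have [u uE] : exists u, z = a - t + h * (2 * u).
  by exists ((z - a + t) / (2 * h)); field; rewrite gt_eqF.
rewrite hE {hE}.
move: zat; rewrite ler_distl => /andP[az za].
have u0 : 0 <= u by have : 0 <= h * (2 * u); [lra|rewrite pmulr_rge0// pmulr_rge0].
have uN : u <= N%:R.
  have : h * (2 * u) <= h * (2 * N%:R) by lra.
  by rewrite !ler_pM2l.
have [j ju uj] : exists2 j : 'I_N, j%:R <= u & u <= j%:R + 1.
  have /andP[tu ut] := truncn_itv u0.
  (* At the right endpoint the integer part is [N] itself, and the last piece is taken instead. *)
  have [tN|tN] := ltnP (Num.truncn u) N.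
    by exists (Ordinal tN); rewrite //= natr1 ltW.
  have jN : (N.-1 < N)%N by rewrite prednK.
  exists (Ordinal jN) => /=; last by rewrite natr1 prednK.
  by apply: le_trans tu; rewrite ler_nat (leq_trans _ tN)// leq_pred.
exists j; rewrite {1}uE opprD addrACA subrr add0r -mulrBr normrM gtr0_norm//.
rewrite -[leRHS]mulr1 ler_wpM2l ?(ltW h0)//.
have -> : (j : nat).*2.+1%:R = 2 * j%:R + 1 :> R by rewrite -natr1 -mul2n natrM.
by rewrite ler_norml; apply/andP; split; lra.
Qed.

(** Of the [N ^ d] subcubes of a cube, one lies in a slab missed by [K]. Discarding just this one
    leaves [N ^ d - 1], giving the exponent [ln (N ^ d - 1) / ln N < d]. *)
Lemma porous_dimA_lt (R : realType) (d : nat) (K : set (euclidean R d)) (E : R) (N : nat)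
    (i0 : 'I_d) :
  0 < E -> (1 < N)%N -> (forall x y, K x -> K y -> mdist x y <= E) ->
  (forall b t, 0 < t -> t <= E -> exists2 c, `|c - b| <= t &
    forall z, K z -> 2 * t / N%:R < `|z 0 i0 - c|) ->
  (dimA K < d%:R%:E)%E.
Proof.
move=> E0 N1 KE hole.
have N0 : (0 < N)%N by apply: ltnW.
have d0 : (0 < d)%N by apply: leq_ltn_trans (ltn_ord i0).
have NR0 : 0 < N%:R :> R by rewrite ltr0n.
have lnN : 0 < ln (N%:R : R) by rewrite ln_gt0// ltr1n.
pose M := (N ^ d).-1.
have Nd1 : (1 < N ^ d)%N by rewrite -(exp1n d) ltn_exp2r.
have M0 : (0 < M)%N by rewrite -ltnS prednK// ltnW.
pose s : R := ln M%:R / ln N%:R.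
have sN : N%:R `^ s = M%:R.
  by rewrite /powR gt_eqF// /s divfK ?gt_eqF// lnK// posrE ltr0n.
apply: (@le_lt_trans _ _ s%:E); last first.
  rewrite lte_fin ltr_pdivrMr// -ln_powR powR_mulrn ?ler0n// -natrX ltr_ln ?posrE ?ltr0n//.
    by rewrite ltr_nat prednK// ltnW.
  exact: ltnW.
have th01 : 0 < (N%:R : R)^-1 < 1 by rewrite invr_gt0 NR0 invf_lt1// ltr1n.
have /andP[th0 th1] := th01.
apply: (dimA_le (M := M) th01 E0) => //.
- by rewrite divr_ge0 ?ln_ge0 ?ler1n// ltW.
- by rewrite invrK sN.
move=> n a; set t := _ ^+ n * E.
have t0 : 0 < t by rewrite mulr_gt0// exprn_gt0.
have tE : t <= E by rewrite ger_pMl// exprn_ile1// ltW.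
rewrite exprS -mulrA -/t (mulrC _ t).
have [c ca cK] := hole (a 0 i0) t t0 tE.
have [jc jcP] := subinterval t0 N0 ca.
pose pt (j : {ffun 'I_d -> 'I_N}) : euclidean R d :=
  \row_i (a 0 i - t + t / N%:R * (j i : nat).*2.+1%:R).
(* The discarded subcube has all indices equal to [jc]. A point of [K] in it would be within
   [t / N + t / N] of the hyperplane at [c]. *)
exists [seq pt j | j <- enum (predC1 [ffun=> jc])].
  by rewrite size_map -cardE cardC1 card_ffun !card_ord.
move=> z Kz az; have /choice[g gP] i := subinterval t0 N0 (az i).
exists (pt (finfun g)); last by move=> i; rewrite mxE ffunE.
apply/map_f; rewrite mem_enum !inE; apply/eqP => /ffunP/(_ i0); rewrite !ffunE => gi0.
have := cK z Kz; rewrite ltNge => /negP; apply.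
rewrite -(subrK (a 0 i0 - t + t / N%:R * (jc : nat).*2.+1%:R) (z 0 i0)) -addrA.
rewrite (le_trans (ler_normD _ _))// (_ : 2 * t / _ = t / N%:R + t / N%:R); last by ring.
rewrite lerD//; first by rewrite -gi0.
by rewrite distrC.
Qed.

(** * Grids and games *)

Section grid.
Context {R : realType} {d : nat}.
Implicit Types (x a g : euclidean R d) (K : compacts (euclidean R d)).

Definition on_grid (delta : R) g := forall i, exists m : int, g 0 i = delta * m%:~R.

(** In each coordinate the grid index differs from the floor of [a 0 i / delta] by at most [w],
    leaving [2 w + 1] values. *)
Lemma grid_cube_finite (delta : R) a (w : nat) : 0 < delta ->
  exists2 l : seq (euclidean R d), (size l <= w.*2.+1 ^ d)%N &
  forall g, on_grid delta g -> cube a (w%:R * delta) g -> g \in l.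
Proof.
move=> delta0.
pose pt (j : {ffun 'I_d -> 'I_w.*2.+1}) : euclidean R d :=
  \row_i (delta * (Num.floor (a 0 i / delta) - w%:Z + (j i : nat)%:Z)%:~R).
exists [seq pt j | j <- enum {ffun 'I_d -> 'I_w.*2.+1}].
  by rewrite size_map -cardE card_ffun !card_ord.
move=> g gd ag.
have /choice[j gj] i : exists j : 'I_w.*2.+1, g 0 i =
    delta * (Num.floor (a 0 i / delta) - w%:Z + (j : nat)%:Z)%:~R.
  have [m gm] := gd i; have := ag i; rewrite gm ler_distl => /andP[].
  set b := a 0 i / delta.
  have -> : a 0 i = delta * b by rewrite mulrC divfK// gt_eqF.
  rewrite (mulrC w%:R) -mulrBr -mulrDr !ler_pM2l// => bm mb.
  have wm : Num.floor b - w%:Z <= m.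
    rewrite -(ler_int R) rmorphB /=; apply: le_trans bm.
    by rewrite lerD2r floor_le.
  have mw : m <= Num.floor b + w%:Z.
    rewrite -ltzD1 -(ltr_int R); apply: (le_lt_trans mb).
    by rewrite addrAC rmorphD /= ltrD2r floorD1_gt.
  have jlt : (absz (m - (Num.floor b - w%:Z))%R < w.*2.+1)%N by lia.
  exists (Ordinal jlt); congr (_ * _%:~R) => /=; lia.
apply/mapP; exists (finfun j); first by rewrite mem_enum.
by apply/rowP => i; rewrite mxE ffunE.
Qed.

Definition grid_floor (delta : R) x : euclidean R d :=
  \row_i (delta * (Num.floor (x 0 i / delta))%:~R).

Lemma grid_floor_on_grid delta x : on_grid delta (grid_floor delta x).
Proof. by move=> i; rewrite mxE; eexists. Qed.

Lemma grid_floor_near (delta : R) x i : 0 < delta ->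
  `|x 0 i - grid_floor delta x 0 i| <= delta.
Proof.
move=> delta0; rewrite mxE; set b := x 0 i / delta.
have -> : x 0 i = delta * b by rewrite mulrC divfK// gt_eqF.
rewrite -mulrBr normrM gtr0_norm// -[leRHS]mulr1 ler_wpM2l ?(ltW delta0)//.
have := floor_le b; have := floorD1_gt b; rewrite rmorphD /= => h1 h2.
by rewrite ger0_norm; lra.
Qed.

(** The construction behind all three moves: round every point to the grid, then add finitely many
    shifts [v j]. The last clause keeps one [g] for all [j], so separation of the shifts passes to
    [L]. *)
Lemma grid_thickening K (delta e : R) (I : finType) (i0 : I) (v : I -> 'rV[R]_d) :
  0 < delta -> 0 <= e -> (forall j i, `|v j 0 i| <= e) ->
  exists L : compacts (euclidean R d),
  [/\ mdist K L <= d%:R * (delta + e),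
      forall p, compacts_set L p -> exists g j, on_grid delta g /\
        p = (g : 'rV[R]_d) + v j &
      forall k, compacts_set K k -> exists g : euclidean R d, forall j,
        compacts_set L ((g : 'rV[R]_d) + v j) /\
        mdist k ((g : 'rV[R]_d) + v j) <= d%:R * (delta + e)].
Proof.
move=> delta0 e0 ve.
pose sh k j : euclidean R d := (grid_floor delta k : 'rV[R]_d) + v j.
pose L := [set p | exists k j, compacts_set K k /\ p = sh k j].
have sh_near k j : mdist k (sh k j) <= d%:R * (delta + e).
  apply: mdist_le_coord => [|i]; first by rewrite addr_ge0// ltW.
  rewrite /sh [((_ : 'rV_d) + _) 0 i]mxE opprD addrA.
  by rewrite (le_trans (ler_normB _ _))// lerD// grid_floor_near.
have L0 : L !=set0 by have [k Kk] := compacts_neq0 K; exists (sh k i0), k, i0.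
have cL : compact L.
  have [k0 Kk0] := compacts_neq0 K; have [E E0 KE] := compacts_bounded K.
  (* Rounded points lie within [E + delta] of [k0] in each coordinate, and [w * delta] exceeds this;
     hence the set is finite. *)
  pose w := (Num.truncn ((E + delta) / delta)).+1.
  have [l _ lP] := grid_cube_finite k0 w delta0.
  apply: finite_compact.
  apply: (@sub_finite_set _ _
     [set` [seq (p.1 : 'rV[R]_d) + v p.2 : euclidean R d | p <- allpairs pair l (enum I)]]).
    move=> _ [k [j [Kk ->]]]; apply/mapP; exists (grid_floor delta k, j) => //.
    apply: allpairs_f; last by rewrite mem_enum.
    apply: lP => [|i]; first exact: grid_floor_on_grid.
    apply: (@le_trans _ _ (E + delta)); last first.
      by rewrite -ler_pdivrMr// ltW// truncnS_gt.
    rewrite -(subrK (k 0 i) (_ 0 i)) -addrA (le_trans (ler_normD _ _))// (addrC E) lerD//.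
      by rewrite distrC grid_floor_near.
    by rewrite (le_trans (coord_le_mdist _ _ _))// KE.
  exact: finite_seq.
exists (Compacts L0 cL); split => /=.
- apply: mdist_compacts_le => /=.
  + have [k _] := compacts_neq0 K; exact: le_trans (mdist_ge0 _ _) (sh_near k i0).
  + by move=> k Kk; exists (sh k i0) => //; exists k, i0.
  + by move=> _ [k [j [Kk ->]]]; exists k.
- move=> _ [k [j [Kk ->]]]; exists (grid_floor delta k), j; split=> //.
  exact: grid_floor_on_grid.
- by move=> k Kk; exists (grid_floor delta k) => j; split; [exists k, j|exact: sh_near].
Qed.

End grid.

(** * Moves that depend only on the current radius and center *)

Definition compacts_point (T : topologicalType) (a : T) : compacts T :=
  Compacts (ex_intro [set a] a erefl) (finite_compact (finite_set1 a)).

Lemma mdist_point_diam (R : realType) (T : metricType R) (a : T) (K : compacts T) r x y :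
  mdist (compacts_point a) K <= r -> compacts_set K x -> compacts_set K y ->
  mdist x y <= 2 * r.
Proof.
rewrite metric_sym => aKr Kx Ky.
have [_ /= -> xa] := mdist_compacts_near aKr Kx.
have [_ /= -> ya] := mdist_compacts_near aKr Ky.
by have := metric_triangle x a y; rewrite (metric_sym a y); lra.
Qed.

Lemma game_radius_gt0 (R : realType) (alpha beta r0 : R) n :
  0 < alpha -> 0 < beta -> 0 < r0 -> 0 < game_radius alpha beta r0 n.
Proof. by move=> *; rewrite mulr_gt0// exprn_gt0// mulr_gt0. Qed.

Lemma game_radiusS (R : realType) (alpha beta r0 : R) n :
  game_radius alpha beta r0 n.+1 = alpha * beta * game_radius alpha beta r0 n.
Proof. by rewrite /game_radius exprS mulrA. Qed.

(** Legal moves nest the balls, so completeness yields a point common to all of them; the radii tend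
    to 0, so it is the only one. *)
Lemma winning_by_move (R : realType) (d : nat) (S : set (compacts (euclidean R d)))
    (alpha : R) (move : R -> compacts (euclidean R d) -> compacts (euclidean R d)) :
  0 < alpha < 1 ->
  (forall r c, 0 < r -> alice_legal alpha r c (move r c)) ->
  (forall beta r0 x z, 0 < beta < 1 -> 0 < r0 ->
    let r := game_radius alpha beta r0 in
    (forall n, mdist (x n) z <= r n) ->
    (forall n, mdist (move (r n) (x n)) z <= alpha * r n) -> S z) ->
  winning S.
Proof.
move=> /[dup] /andP[al0 al1] al01 mlegal moutcome; exists alpha => // beta be01.
have /andP[be0 be1] := be01.
pose K0 := compacts_point ((0 : 'rV[R]_d) : euclidean R d).
(* A history of [n.+1] centers calls for the move at radius index [n], hence [.-1]. The default [K0]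
   is never reached on a nonempty history. *)
pose sigma (r0 : R) (s : seq (compacts (euclidean R d))) :=
  move (game_radius alpha beta r0 (size s).-1) (last K0 s).
exists sigma => r0 x r00 r y.
have yE n : y n = move (r n) (x n).
  by rewrite /y /answer /sigma size_mkseq -nth_last size_mkseq nth_mkseq.
have rgt0 n : 0 < r n by exact: game_radius_gt0.
split => [n _|blegal]; first by rewrite yE; exact: mlegal.
have xr n : mdist (x n) (x n.+1) + r n.+1 <= r n.
  have := blegal n; have := mlegal (r n) (x n) (rgt0 n).
  rewrite /bob_legal /alice_legal -yE -game_radiusS -/(r n.+1).
  by have := metric_triangle (x n) (y n) (x n.+1); lra.
have [z xz] := compacts_complete (fun n => ltW (rgt0 n)) xr.
have yz n : mdist (y n) z <= alpha * r n.
  have := blegal n; rewrite /bob_legal -game_radiusS -/(r n.+1).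
  by have := metric_triangle (y n) (x n.+1) z; have := xz n.+1; lra.
exists z; last first.
  by apply: (moutcome beta r0 x) => // n; rewrite -yE.
apply/seteqP; split => [z' xz'|_ -> n _]; last by split; [exact: xz|exact: yz].
apply: mdist_positivity; apply/eqP; rewrite eq_le mdist_ge0 andbT.
apply/ler_addgt0Pl => e e0; rewrite addr0.
have ab01 : 0 < alpha * beta < 1.
  by rewrite mulr_gt0//= mulr_ilt1// ltW.
have e20 : 0 < e / 2 by rewrite divr_gt0.
have [n [rn _]] := exists_scale r0 ab01 e20.
have := (xz' n I).1; have := xz n; rewrite /cball /= /r /game_radius.
by have := metric_triangle z' (x n) z; rewrite (metric_sym z' (x n)); lra.
Qed.

(** Bob's reply map and any strategy of Alice determine a single legal run, whose outcome would lie
    in [S]. One [beta] per [alpha] is enough to refute winning. *)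
Lemma not_winning_by_move (R : realType) (Y : metricType R) (S : set Y) :
  (forall alpha, 0 < alpha < 1 -> exists beta r0 (x0 : Y) (move : R -> Y -> Y),
    let r := game_radius alpha beta r0 in
    [/\ 0 < beta < 1, 0 < r0,
      forall n y, bob_legal alpha beta (r n) y (move (r n) y) &
      forall x y z, x 0%N = x0 -> (forall n, x n.+1 = move (r n) (y n)) ->
        (forall n, alice_legal alpha (r n) (x n) (y n)) ->
        (forall n, mdist (x n) z <= r n) -> ~ S z]) ->
  ~ winning S.
Proof.
move=> bob [alpha al01 awin].
have [beta [r0 [x0 [move [be01 r00 blegal bwins]]]]] := bob alpha al01.
have [sigma wsigma] := awin beta be01.
pose r := game_radius alpha beta r0.
(* [hist n] lists Bob's centers up to index [n], built by alternating [sigma] and [move]. *)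
pose hist := fix h n := if n is m.+1 then rcons (h m) (move (r m) (sigma r0 (h m)))
  else [:: x0].
pose x n := last x0 (hist n).
have histE n : hist n = mkseq x n.+1.
  by elim: n => [//|n IH]; rewrite mkseqS -IH /x /= last_rcons.
have xS n : x n.+1 = move (r n) (answer sigma r0 x n).
  by rewrite /x /= last_rcons /answer histE.
have [alegal win] := wsigma r0 x r00.
have leg n : bob_legal alpha beta (r n) (answer sigma r0 x n) (x n.+1).
  by rewrite xS; exact: blegal.
have [z xz Sz] := win leg.
apply: (bwins x (answer sigma r0 x) z) => // n; first exact: alegal.
have : [set z] z by []. rewrite -xz => /(_ n I)[]//.
Qed.

(** * The strategies *)

Section alice.
Context {R : realType} {d : nat}.
Hypothesis d_ge1 : (1 <= d)%N.
Let dR : R := d%:R.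
Let dR_gt0 : 0 < dR. Proof. by rewrite ltr0n. Qed.

(** The mesh is chosen so that rounding plus shift costs [d * (2 * delta) = r / 2]. The unshifted
    and the shifted copy of a grid point are the two separated points. *)
Lemma alice_step (c : compacts (euclidean R d)) r : 0 < r ->
  let delta := r / (4 * dR) in exists L : compacts (euclidean R d),
  [/\ mdist c L <= r / 2,
     forall p, compacts_set L p -> on_grid delta p &
     forall k, compacts_set c k -> exists2 g : bool -> euclidean R d,
       forall b, compacts_set L (g b) /\ mdist k (g b) <= r / 2 &
       delta <= mdist (g true) (g false)].
Proof.
move=> r0 delta; have delta0 : 0 < delta by rewrite divr_gt0 ?mulr_gt0.
have [|L [cL Lgrid Lc]] := @grid_thickening _ _ c delta delta bool true
    (fun b => const_mx (if b then delta else 0)) delta0 (ltW delta0).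
  by move=> b i; rewrite mxE; case: b; rewrite ?normr0 ?gtr0_norm// ltW.
have r2E : d%:R * (delta + delta) = r / 2 by rewrite /delta; field; rewrite gt_eqF.
rewrite r2E in cL Lc.
exists L; split => // [p /Lgrid[g [b [gg ->]]] i|k /Lc[g gP]].
  have [m gm] := gg i; rewrite !mxE gm; case: b.
    by exists (m + 1); rewrite rmorphD mulrDr mulr1.
  by exists m; rewrite addr0.
pose h b : euclidean R d := (g : 'rV_d) + const_mx (if b then delta else 0).
exists h => //; apply: le_trans (coord_le_mdist (h true) (h false) (Ordinal d_ge1)).
by rewrite !mxE addr0 addrAC subrr add0r gtr0_norm.
Qed.

End alice.

Section alice_outcome.
Context {R : realType} {d : nat}.
Hypothesis d_ge1 : (1 <= d)%N.
Let dR : R := d%:R.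
Variables (beta r0 : R).
Hypotheses (beta_gt0 : 0 < beta) (beta_lt1 : beta < 1) (r0_gt0 : 0 < r0).
Let alpha : R := (64 * dR)^-1.
Let r := game_radius alpha beta r0.
Let delta n : R := r n / (4 * dR).
Variables (x y : nat -> compacts (euclidean R d)) (z : compacts (euclidean R d)).
Hypothesis xz : forall n, mdist (x n) z <= r n.
Hypothesis yz : forall n, mdist (y n) z <= alpha * r n.
Hypothesis y_grid : forall n p, compacts_set (y n) p -> on_grid (delta n) p.
Hypothesis y_split : forall n k, compacts_set (x n) k ->
  exists2 g : bool -> euclidean R d,
    forall b, compacts_set (y n) (g b) /\ mdist k (g b) <= r n / 2 &
    delta n <= mdist (g true) (g false).

Let dR_ge1 : 1 <= dR. Proof. by rewrite ler1n. Qed.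
Let alpha_gt0 : 0 < alpha. Proof. by rewrite invr_gt0; have := dR_ge1; lra. Qed.
Let alpha_le : alpha <= 64^-1.
Proof. by rewrite lef_pV2 ?posrE; have := dR_ge1; lra. Qed.
Let r_gt0 n : 0 < r n. Proof. exact: game_radius_gt0. Qed.
Let deltaE n : delta n = 16 * (alpha * r n).
Proof. by rewrite /delta /alpha; field; rewrite gt_eqF// (lt_le_trans _ dR_ge1). Qed.
Let delta_gt0 n : 0 < delta n.
Proof. by rewrite deltaE; have := mulr_gt0 alpha_gt0 (r_gt0 n); lra. Qed.
Let ab_gt0 : 0 < alpha * beta. Proof. exact: mulr_gt0. Qed.
Let ab_le : alpha * beta <= 2^-1.
Proof.
by apply: (@le_trans _ _ alpha); [rewrite ger_pMr// ltW|have := alpha_le; lra].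
Qed.

Let ab01 : 0 < alpha * beta < 1.
Proof. by rewrite ab_gt0 (le_lt_trans ab_le)// invf_lt1// ltr1n. Qed.

(** The two points Alice creates are [delta n = 16 * alpha * r n] apart and move by at most
    [alpha * r n] afterwards. Binary branching with ratio [alpha * beta] gives the exponent [s]. *)
Lemma alice_dimL_gt0 : (0 < dimL z)%E.
Proof.
have abi1 : 1 < (alpha * beta)^-1 by have /andP[] := ab01; rewrite invf_gt1.
have lnab : 0 < ln (alpha * beta)^-1 by rewrite ln_gt0.
pose s := ln 2 / ln (alpha * beta)^-1.
have ln2 : 0 < ln (2 : R) by rewrite ln_gt0// ltr1n.
have s0 : 0 < s by rewrite divr_gt0.
have [E E0 zE] := compacts_bounded z.
apply: (@lt_le_trans _ _ s%:E); first by rewrite lte_fin.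
(* With scale [4 * r n] the allowed displacement is [2 * r n], against [r n + r n / 2 + r n / 64]
   used; the required gap [8 * r n.+1] is below the available [14 * alpha * r n]. *)
have t0 : 0 < 4 * r0 by rewrite mulr_gt0.
apply: (dimL_ge (I := bool) ab_gt0 ab_le t0 (ltW s0) E0) => //.
  by rewrite card_bool /powR gt_eqF ?invr_gt0// /s divfK ?gt_eqF// lnK// posrE.
move=> n u zu.
have tE m : (alpha * beta) ^+ m * (4 * r0) = 4 * r m by rewrite /r /game_radius; ring.
rewrite !tE.
have zx : mdist z (x n) <= r n by rewrite metric_sym.
have [p xp up] := mdist_compacts_near zx zu.
have [g gy gsep] := y_split xp.
have /choice[f fP] b : exists w, compacts_set z w /\ mdist (g b) w <= alpha * r n.
  by have [w ? ?] := mdist_compacts_near (yz n) (gy b).1; exists w.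
have ar : alpha * r n <= 64^-1 * r n by rewrite ler_wpM2r// ltW.
have rS : r n.+1 <= alpha * r n.
  rewrite /r game_radiusS -mulrA mulrCA ger_pMl ?(ltW beta_lt1)//.
  exact: (mulr_gt0 alpha_gt0 (r_gt0 n)).
have fsep : 2 * (4 * r n.+1) < mdist (f true) (f false).
  have := metric_triangle (g true) (f true) (g false).
  have := metric_triangle (f true) (f false) (g false).
  rewrite (metric_sym (f false)); have := (fP true).2; have := (fP false).2.
  have := mulr_gt0 alpha_gt0 (r_gt0 n).
  by move: gsep; rewrite deltaE; lra.
exists f => [b|[] []//]; last by rewrite metric_sym.
split; first exact: (fP b).1.
have := (gy b).2; have := (fP b).2; have := r_gt0 n.
by have := metric_triangle u p (f b); have := metric_triangle p (g b) (f b); lra.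
Qed.

(** In coordinate [i0] the outcome stays within [delta m / 16] of multiples of [delta m], so every
    hyperplane at a half-integer multiple is the middle of a gap. *)
Lemma alice_dimA_lt : (dimA z < d%:R%:E)%E.
Proof.
have [E E0 zE] := compacts_bounded z.
have Q0 : 0 < 4 / (alpha * beta) by rewrite divr_gt0.
have Q1 : 0 < 8 * E / delta 0 by apply: divr_gt0 (delta_gt0 0); rewrite mulr_gt0.
(* The first term handles sizes [t] up to [E] at the coarsest grid [m = 0]; the second absorbs the
   ratio of consecutive meshes. Both give [8 * t <= N * delta m]. *)
pose N := (Num.truncn (8 * E / delta 0 + 4 / (alpha * beta))).+2.
have NQ : 8 * E / delta 0 + 4 / (alpha * beta) <= N%:R.
  by rewrite ltW// (lt_trans (truncnS_gt _))// ltr_nat.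
have N0 : 0 < N%:R :> R by rewrite ltr0n.
pose i0 := Ordinal d_ge1.
apply: (porous_dimA_lt (N := N) (i0 := i0) E0) => // b t t0 tE.
have t20 : 0 < 2 * t by rewrite mulr_gt0.
have [m [mt mt']] := exists_scale (delta 0) ab01 t20.
have dE n : (alpha * beta) ^+ n * delta 0 = delta n.
  by rewrite /delta /r /game_radius expr0 mul1r mulrA.
rewrite !dE in mt mt'.
have Nt : 8 * t <= N%:R * delta m.
  case: m {mt} mt' => [_|m /(_ isT)/= mt'].
    rewrite -ler_pdivrMr//; apply: le_trans NQ.
    apply: (@le_trans _ _ (8 * E / delta 0)); last by rewrite lerDl ltW.
    by rewrite ler_pM2r ?invr_gt0// ler_pM2l.
  apply: (@le_trans _ _ (4 / (alpha * beta) * delta m.+1)); last first.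
    by rewrite ler_wpM2r ?(ltW (delta_gt0 _))//; lra.
  have -> : delta m.+1 = alpha * beta * delta m by rewrite -(dE m.+1) exprS -mulrA dE.
  by rewrite mulrA divfK ?gt_eqF//; lra.
(* [c] is the first half-integer multiple of [delta m] beyond [b - t]; since [delta m <= 2 * t], it
   does not pass [b + t]. *)
pose q := Num.floor ((b - t) / delta m + 2^-1).
pose c := delta m * (q%:~R + 2^-1).
have cb : `|c - b| <= t.
  have := floor_le ((b - t) / delta m + 2^-1).
  have := floorD1_gt ((b - t) / delta m + 2^-1); rewrite -/q rmorphD /= => q1 q2.
  have bE : b - t = delta m * ((b - t) / delta m) by rewrite mulrC divfK// gt_eqF.
  have c1 : b - t <= c by rewrite bE ler_pM2l//; lra.
  have c2 : c <= b - t + delta m.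
    by rewrite bE -[X in _ + X]mulr1 -mulrDr ler_pM2l//; lra.
  by rewrite ler_distl; apply/andP; split; lra.
exists c => // u zu.
have zy : mdist z (y m) <= alpha * r m by rewrite metric_sym.
have [p yp up] := mdist_compacts_near zy zu.
have [k pk] := y_grid yp i0.
(* The gap suffices because [1/2 - 1/16 > 1/4]. *)
have t2 : 2 * t / N%:R <= delta m / 4 by rewrite ler_pdivrMr//; lra.
have half : delta m / 2 <= `|p 0 i0 - c|.
  rewrite pk /c -mulrBr normrM gtr0_norm// ler_pM2l//.
  have [kq|qk] := leP k q.
    have : (k%:~R : R) <= q%:~R by rewrite ler_int.
    by move=> ?; rewrite ler0_norm; lra.
  have : (q + 1)%:~R <= k%:~R :> R by rewrite ler_int lezD1.
  by rewrite rmorphD /= => ?; rewrite ger0_norm; lra.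
have up' := le_trans (coord_le_mdist _ _ i0) up.
have := ler_distD (u 0 i0) (p 0 i0) c; rewrite distrC in up'.
have := deltaE m; have := delta_gt0 m; lra.
Qed.

End alice_outcome.

(** * Bob forces small Assouad dimension *)

Section bob_thin.
Context {R : realType} {d : nat}.
Hypothesis d_ge1 : (1 <= d)%N.

Let dR_gt0 : 0 < d%:R :> R. Proof. by rewrite ltr0n. Qed.

(** The branching number [M] depends on [alpha] and [d] only, so [beta] can be taken afterwards so
    small that [M <= (alpha * beta) ^- eps]. *)
Lemma not_winning_dimA_gt (eps : R) : 0 < eps ->
  ~ winning [set K : compacts (euclidean R d) | (eps%:E < dimA K)%E].
Proof.
move=> eps0; apply: not_winning_by_move => alpha /andP[al0 al1].
(* The relevant grid points lie within [3 * r n] of the cube's center, which is [6 * d / alpha]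
   times the mesh [alpha * r n / (2 * d)]. *)
pose w := (Num.truncn (6 * d%:R / alpha)).+1.
pose M := (w.*2.+1 ^ d)%N.
have M1 : 1 <= M%:R :> R by rewrite ler1n expn_gt0.
pose B := M%:R `^ (eps^-1).
have B1 : 1 <= B by rewrite -(powRr0 M%:R) ler_powR// invr_ge0 ltW.
pose beta := (2 * B)^-1.
have be0 : 0 < beta by rewrite invr_gt0; lra.
have be2 : beta <= 2^-1 by rewrite lef_pV2 ?posrE; lra.
have be01 : 0 < beta < 1 by apply/andP; split; lra.
(* Positivity of [rho] is assumed inside the existential so that choice yields a total move. *)
have step rho (c : compacts (euclidean R d)) : exists L : compacts (euclidean R d),
    0 < rho -> let delta := alpha * rho / (2 * d%:R) in
    mdist c L <= alpha * rho / 2 /\ forall p, compacts_set L p -> on_grid delta p.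
  have [rho0|] := boolP (0 < rho); last by exists c.
  pose delta := alpha * rho / (2 * d%:R).
  have delta0 : 0 < delta by rewrite divr_gt0 ?mulr_gt0.
  have [|L [cL Lgrid _]] := @grid_thickening _ _ c delta 0 unit tt
      (fun=> 0) delta0 (lexx 0).
    by move=> _ i; rewrite mxE normr0.
  exists L => _; split; last by move=> p /Lgrid[g [_ [gg ->]]]; rewrite addr0.
  apply: (le_trans cL); rewrite le_eqVlt; apply/orP; left; apply/eqP.
  by rewrite /delta; field; rewrite gt_eqF.
have /choice[move moveP] p := step p.1 p.2.
exists beta, 1, (compacts_point ((0 : 'rV[R]_d) : euclidean R d)),
  (fun rho c => move (rho, c)) => r.
have r_gt0 n : 0 < r n by exact: game_radius_gt0.
split => // [n c|x y z x0 xS _ xz].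
  have [cL _] := moveP (r n, c) (r_gt0 n); rewrite /= in cL.
  have ar0 : 0 <= alpha * r n by rewrite ltW// (mulr_gt0 al0 (r_gt0 n)).
  by rewrite /bob_legal; have := ler_wpM2r ar0 be2; lra.
move=> /=; apply/negP; rewrite -leNgt.
have th01 : 0 < alpha * beta < 1.
  by rewrite mulr_gt0//= mulr_ilt1// ?ltW//; lra.
(* Cubes have half-side [2 * r n]: at [n = 0] this bounds the diameter of the outcome, and later it
   covers the points within [r n] of a center. *)
have t0 : 0 < 2 :> R by [].
apply: (dimA_le (M := M) th01 t0 (ltW eps0)) => [|u v zu zv|n a].
- apply: (@le_trans _ _ (B `^ eps)).
    by rewrite -powRrM mulVf ?powRr1// gt_eqF.
  apply: ge0_ler_powR; rewrite ?nnegrE ?(ltW eps0)//.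
  + lra.
  + by rewrite invr_ge0 mulr_ge0 ?ltW.
  + have iB : 0 < B^-1 by rewrite invr_gt0; lra.
    rewrite -[leLHS]invrK lef_pV2 ?posrE ?mulr_gt0//.
    apply: (@le_trans _ _ beta); first by rewrite ger_pMl// ltW.
    by rewrite /beta lef_pV2 ?posrE; lra.
- have := xz 0%N; rewrite x0 => /mdist_point_diam/(_ zu zv).
  by rewrite /r /game_radius expr0 !mulr1.
have tE m : (alpha * beta) ^+ m * 2 = 2 * r m by rewrite /r /game_radius mulr1 mulrC.
rewrite !tE.
pose delta := alpha * r n / (2 * d%:R).
have delta0 : 0 < delta by apply: divr_gt0; [exact: mulr_gt0|rewrite mulr_gt0].
have [l lM lP] := grid_cube_finite a w delta0; exists l => // u zu au.
have zx : mdist z (x n.+1) <= r n.+1 by rewrite metric_sym.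
have [p xp up] := mdist_compacts_near zx zu.
have pu i : `|u 0 i - p 0 i| <= r n.+1 by exact: le_trans (coord_le_mdist _ _ _) up.
exists p; last by move=> i; have := pu i; have := r_gt0 n.+1; lra.
apply: lP.
  by move: xp; rewrite xS => /((moveP (r n, y n) (r_gt0 n)).2).
move=> i; have rS : r n.+1 <= r n by rewrite /r game_radiusS ger_pMl// ltW// (andP th01).2.
apply: (@le_trans _ _ (3 * r n)).
  have := ler_distD (u 0 i) (p 0 i) (a 0 i); rewrite (distrC (p 0 i) (u 0 i)).
  by have := pu i; have := au i; lra.
have dw : 6 * d%:R / alpha <= w%:R by rewrite ltW// truncnS_gt.
rewrite (_ : 3 * r n = 6 * d%:R / alpha * delta); first by rewrite ler_wpM2r// ltW.
by rewrite /delta; field; rewrite !gt_eqF.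
Qed.

End bob_thin.

(** * Bob forces large lower dimension *)

Section bob_thick.
Context {R : realType} {d : nat}.
Hypothesis d_ge1 : (1 <= d)%N.

Let dR_gt0 : 0 < d%:R :> R. Proof. by rewrite ltr0n. Qed.

(** Since [s < d], the factor [J ^ (d - s)] eventually absorbs the constant [c ^ s]. *)
Lemma thick_count (c s : R) : 0 < c -> s < d%:R -> exists J : nat,
  (0 < J)%N /\ (c * J%:R) `^ s <= (J ^ d)%:R.
Proof.
move=> c0 sd; have ds0 : 0 < d%:R - s by rewrite subr_gt0.
pose a := (c `^ s) `^ (d%:R - s)^-1.
exists (Num.truncn a).+1; split => //; set J := _.+1.
have J0 : 0 < J%:R :> R by rewrite ltr0n.
have aJ : a <= J%:R by rewrite ltW// truncnS_gt.
rewrite powRM ?(ltW c0) ?(ltW J0)// natrX -powR_mulrn ?ler0n//.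
rewrite -(subrK s d%:R) powRD; last first.
  by rewrite (gt_eqF J0) implybT.
rewrite ler_wpM2r ?powR_ge0//.
have -> : c `^ s = a `^ (d%:R - s) by rewrite /a -powRrM mulVf ?powRr1 ?powR_ge0// gt_eqF.
by apply: ge0_ler_powR; rewrite ?nnegrE ?powR_ge0 ?(ltW ds0) ?(ltW J0).
Qed.

Lemma grid_block_separated (J : nat) (eta : R) (g : euclidean R d)
    (j j' : {ffun 'I_d -> 'I_J}) : 0 <= eta -> j != j' ->
  eta <= mdist ((g : 'rV[R]_d) + \row_i (eta * (j i)%:R) : euclidean R d)
               ((g : 'rV[R]_d) + \row_i (eta * (j' i)%:R) : euclidean R d).
Proof.
move=> eta0 jj'.
have [i ji] : exists i, j i != j' i.
  apply/existsP; apply: contraT; rewrite negb_exists => /forallP jE.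
  by case/negP: jj'; apply/eqP/ffunP => i; apply/eqP; move: (jE i); rewrite negbK.
apply: le_trans (coord_le_mdist _ _ i).
rewrite !mxE opprD addrACA subrr add0r -mulrBr normrM ger0_norm//.
rewrite -[leLHS]mulr1 ler_wpM2l//.
have := ji; rewrite -val_eqE /= neq_ltn => /orP[] jlt.
  rewrite distrC; have : ((j i).+1%:R : R) <= (j' i)%:R by rewrite ler_nat.
  by rewrite -natr1 => ?; rewrite ger0_norm; lra.
have : ((j' i).+1%:R : R) <= (j i)%:R by rewrite ler_nat.
by rewrite -natr1 => ?; rewrite ger0_norm; lra.
Qed.

Lemma not_winning_dimL_lt (eps : R) : 0 < eps ->
  ~ winning [set K : compacts (euclidean R d) | (dimL K < (d%:R - eps)%:E)%E].
Proof.
move=> eps0; apply: not_winning_by_move => alpha /andP[al0 al1].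
have dR1 : 1 <= d%:R :> R by rewrite ler1n.
(* The lower bound needs a nonnegative exponent, while [d - eps] may be negative. *)
pose s := Num.max (d%:R - eps) 0.
have s0 : 0 <= s by rewrite le_max lexx orbT.
have sd : s < d%:R by rewrite gt_max dR_gt0 andbT; lra.
(* With the [beta] below, [c * J] is exactly [(alpha * beta)^-1]. *)
pose c := 80 * d%:R / alpha.
have c0 : 0 < c by rewrite divr_gt0// mulr_gt0.
have [J [J0 cJ]] := thick_count c0 sd.
have JR1 : 1 <= J%:R :> R by rewrite ler1n.
have JR0 : 0 < J%:R :> R by rewrite ltr0n.
have dJ1 : 1 <= d%:R * J%:R :> R by rewrite mulr_ege1.
(* With the constant 80 the mesh of the block is 20 r_(n+1), so that moving its
   points by r_(n+1) leaves them more than 16 r_(n+1) apart. *)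
pose beta : R := (80 * (d%:R * J%:R))^-1.
have be0 : 0 < beta by rewrite invr_gt0; lra.
have be2 : beta <= 80^-1 by rewrite lef_pV2 ?posrE; lra.
have be01 : 0 < beta < 1 by apply/andP; split; lra.
(* [J] steps of length [eta rho] span [alpha * rho / (4 * d)], the mesh used for rounding, so
   rounding and block together cost [alpha * rho / 2]. *)
pose eta rho : R := alpha * rho / (4 * (d%:R * J%:R)).
pose v rho (j : {ffun 'I_d -> 'I_J}) : 'rV[R]_d := \row_i (eta rho * (j i)%:R).
have step rho (k : compacts (euclidean R d)) : exists L : compacts (euclidean R d),
    0 < rho -> mdist k L <= alpha * rho / 2 /\
    forall p, compacts_set k p -> exists g : euclidean R d, forall j,
        compacts_set L ((g : 'rV[R]_d) + v rho j) /\
        mdist p ((g : 'rV[R]_d) + v rho j) <= alpha * rho / 2.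
  have [rho0|] := boolP (0 < rho); last by exists k.
  pose delta := alpha * rho / (4 * d%:R).
  have delta0 : 0 < delta by rewrite divr_gt0 ?mulr_gt0.
  have eta0 : 0 < eta rho by rewrite divr_gt0 ?mulr_gt0.
  have [|L [kL _ kg]] := @grid_thickening _ _ k delta delta {ffun 'I_d -> 'I_J}
      [ffun=> Ordinal J0] (v rho) delta0 (ltW delta0).
    move=> j i; rewrite mxE ger0_norm; last by rewrite mulr_ge0 ?ler0n ?(ltW eta0).
    rewrite (_ : delta = eta rho * J%:R); last first.
      by rewrite /delta /eta; field; rewrite !gt_eqF.
    by rewrite ler_wpM2l ?(ltW eta0)// ler_nat ltnW.
  have dE : d%:R * (delta + delta) = alpha * rho / 2.
    by rewrite /delta; field; rewrite gt_eqF.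
  by rewrite dE in kL kg; exists L => _; split.
have /choice[move moveP] p := step p.1 p.2.
exists beta, 1, (compacts_point ((0 : 'rV[R]_d) : euclidean R d)),
  (fun rho c => move (rho, c)) => r.
have r_gt0 n : 0 < r n by exact: game_radius_gt0.
split => // [n k|x y z x0 xS xy xz].
  have [cL _] := moveP (r n, k) (r_gt0 n); rewrite /= in cL.
  have ar0 : 0 <= alpha * r n by rewrite ltW// (mulr_gt0 al0 (r_gt0 n)).
  by rewrite /bob_legal; have := ler_wpM2r ar0 be2; lra.
move=> /=; apply/negP; rewrite -leNgt.
apply: (@le_trans _ _ s%:E); first by rewrite lee_fin le_max lexx.
have ab0 : 0 < alpha * beta by rewrite mulr_gt0.
have ab2 : alpha * beta <= 2^-1.
  by apply: (@le_trans _ _ beta); [rewrite ger_pMl// ltW|lra].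
(* Scale [8 * r n] allows displacement [4 * r n]: from the outcome to [x n], on to [y n], then to
   the block and back to the outcome takes at most [r n + r n + r n / 2 + r n]. *)
apply: (@dimL_ge _ _ _ (alpha * beta) 8 s 2 {ffun 'I_d -> 'I_J}) => //.
- rewrite card_ffun !card_ord; apply: le_trans cJ.
  rewrite le_eqVlt; apply/orP; left; apply/eqP; congr (_ `^ _).
  by rewrite /c /beta; field; rewrite !gt_eqF.
- move=> u w zu zw; have := xz 0%N; rewrite x0 => /mdist_point_diam/(_ zu zw).
  by rewrite /r /game_radius expr0 !mulr1.
move=> n u zu.
have tE m : (alpha * beta) ^+ m * 8 = 8 * r m by rewrite /r /game_radius mulr1 mulrC.
rewrite !tE.
have zx : mdist z (x n) <= r n by rewrite metric_sym.
have [p xp up] := mdist_compacts_near zx zu.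
have xyn : mdist (x n) (y n) <= r n.
  by have := xy n; have := mulr_gt0 al0 (r_gt0 n); rewrite /alice_legal; lra.
have [q yq pq] := mdist_compacts_near xyn xp.
have [_ /(_ q yq)[g gP]] := moveP (r n, y n) (r_gt0 n).
rewrite /= -xS in gP.
have /choice[f fP] j : exists k, compacts_set z k /\
    mdist ((g : 'rV[R]_d) + v (r n) j : euclidean R d) k <= r n.+1.
  by have [k ? ?] := mdist_compacts_near (xz n.+1) (gP j).1; exists k.
have arn : alpha * r n <= r n by rewrite ger_pMl// ltW.
have rS : r n.+1 <= r n.
  rewrite /r game_radiusS ger_pMl ?r_gt0//; lra.
exists f => [j|j j' jj'].
  split; first exact: (fP j).1.
  have := (fP j).2; have := (gP j).2.
  have := metric_triangle u p (f j); have := metric_triangle p q (f j).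
  have := metric_triangle q ((g : 'rV[R]_d) + v (r n) j : euclidean R d) (f j).
  by have := r_gt0 n; lra.
have eta0 : 0 <= eta (r n).
  by apply: divr_ge0; [exact/ltW/mulr_gt0|rewrite mulr_ge0// ltW// mulr_gt0].
have etaE : eta (r n) = 20 * r n.+1.
  by rewrite /r game_radiusS -/r /eta /beta; field; rewrite !gt_eqF.
have := grid_block_separated g eta0 jj'.
have := (fP j).2; have := (fP j').2; have := r_gt0 n.+1; rewrite -/(v _ j) -/(v _ j') etaE.
set gj : euclidean R d := (g : 'rV_d) + v (r n) j.
set gj' : euclidean R d := (g : 'rV_d) + v (r n) j'.
have := metric_triangle gj (f j) gj'; have := metric_triangle (f j) (f j') gj'.
rewrite (metric_sym (f j') gj'); lra.
Qed.

End bob_thick.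

Theorem corollary2p7 (R : realType) (d : nat) (d_ge1 : (1 <= d)%N) :
  winning [set K : compacts (euclidean R d) |
    (0 < dimL K)%E /\ (dimL K <= dimA K)%E /\ (dimA K < d%:R%:E)%E] /\
  (forall eps : R, 0 < eps ->
    ~ winning [set K : compacts (euclidean R d) | (eps%:E < dimA K)%E] /\
    ~ winning [set K : compacts (euclidean R d) | (dimL K < (d%:R - eps)%:E)%E]).
Proof.
split; last by move=> eps eps0; split;
  [exact: not_winning_dimA_gt|exact: not_winning_dimL_lt].
have dR1 : 1 <= d%:R :> R by rewrite ler1n.
have step (p : R * compacts (euclidean R d)) : exists L : compacts (euclidean R d),
    0 < p.1 -> [/\ mdist p.2 L <= p.1 / 2,
     forall q, compacts_set L q -> on_grid (p.1 / (4 * d%:R)) q &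
     forall k, compacts_set p.2 k -> exists2 g : bool -> euclidean R d,
       forall b, compacts_set L (g b) /\ mdist k (g b) <= p.1 / 2 &
       p.1 / (4 * d%:R) <= mdist (g true) (g false)].
  (* For a nonpositive radius any compact set serves; this makes the move total. *)
  have [r0|] := boolP (0 < p.1); last by exists p.2.
  by have [L LP] := alice_step d_ge1 p.2 r0; exists L.
have [move moveP] := choice step.
have al0 : 0 < (64 * d%:R : R)^-1 by rewrite invr_gt0; lra.
have al64 : (64 * d%:R : R)^-1 <= 64^-1 by rewrite lef_pV2 ?posrE; lra.
apply: (@winning_by_move _ _ _ (64 * d%:R)^-1 (fun r c => move (r, c))).
- by apply/andP; split; lra.
- move=> r c r0; have [cm _ _] := moveP (r, c) r0; rewrite /= in cm.
  by rewrite /alice_legal; have := ler_wpM2r (ltW r0) al64; lra.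
move=> beta r0 x z /andP[be0 be1] r00 r xz yz.
have rgt0 n : 0 < r n by exact: game_radius_gt0.
have grid n p : compacts_set (move (r n, x n)) p -> on_grid (r n / (4 * d%:R)) p.
  by have [_ + _] := moveP (r n, x n) (rgt0 n); exact.
split; last split.
- apply: (alice_dimL_gt0 d_ge1 be0 be1 r00 xz yz) => n.
  by have [_ _] := moveP (r n, x n) (rgt0 n).
- by apply: dimL_le_dimA; exact: compacts_neq0.
- exact: (alice_dimA_lt d_ge1 be0 be1 r00 yz grid).
Qed.
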